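(* Let $(\Omega,\Sigma,\mu)$ be a measure space with $L_1(\mu)\neq\{0\}$. Then $\mathfrak{pDau}(L_1(\mu))=1$.
   Context: All Banach spaces are real. $B_X$ and $S_X$ denote the closed unit ball and unit sphere of a Banach space $X$. A slice of $B_X$ is a nonempty intersection of $B_X$ with an open half-space, i.e. a set $\{x\in B_X: f(x)>\sup f(B_X)-\alpha\}$ with $f\in X^*$, $\alpha>0$. For a cardinal $\kappa$ (finite or infinite), $\{y_\alpha:\alpha<\kappa\}$ denotes a set of cardinality at most $\kappa$. $X$ has the $\kappa$-perfect Daugavet property if for every family $\{y_\alpha:\alpha<\kappa\}\subseteq S_X$ and every slice $S$ of $B_X$ there is $x\in S$ with $\|y_\alpha+x\|=2$ for all $\alpha<\kappa$. For nonzero $X$, $\mathfrak{pDau}(X)$ is the least cardinal $\kappa$ such that $X$ fails the $\kappa$-perfect Daugavet property (every Banach space has the $0$-perfect Daugavet property). *)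

(* Defs.v *)
From HB Require Import structures.
From mathcomp Require Import all_boot all_order all_algebra.
From mathcomp Require Import all_classical all_reals all_analysis.
From mathcomp Require Import measurable_realfun ess_sup_inf.
Import Order.TTheory GRing.Theory Num.Def Num.Theory.
Import numFieldNormedType.Exports.

Set Implicit Arguments.
Unset Strict Implicit.
Unset Printing Implicit Defensive.

Local Open Scope classical_set_scope.
Local Open Scope card_scope.
Local Open Scope quotient_scope.
Local Open Scope ring_scope.

Lemma ae_eq_Lnorm d (T : measurableType d) (R : realType)
    (mu : {measure set T -> \bar R}) (p : \bar R) (f g : T -> R) :
  (1 <= p)%E -> measurable_fun setT f -> measurable_fun setT g ->
  f = g %[ae mu] -> ('N[mu]_p[EFin \o f] = 'N[mu]_p[EFin \o g])%E.
Proof.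
rewrite unlock; case: p => [r _|_|//] mf mg fg /=.
- congr (_ `^ _)%E; apply: ge0_ae_eq_integral => //.
  + by apply/measurable_EFinP;
      apply: (@measurableT_comp _ _ _ _ _ _ (@powR R ^~ r)) => //;
      exact: measurableT_comp.
  + by apply/measurable_EFinP;
      apply: (@measurableT_comp _ _ _ _ _ _ (@powR R ^~ r)) => //;
      exact: measurableT_comp.
  + by apply: filterS fg => x + _ => /(_ I)/= ->.
- case: ifPn => // _; apply: eq_ess_sup.
  by apply: filterS fg => x /(_ I)/= ->.
Qed.

(* The library provides L^p as a quotient type but without vector space or
   norm; this section equips it with the pointwise operations on
   representatives (Lspace_addE, Lspace_scaleE) and the L^p norm. *)
Section Lspace_normed.
Context d (T : measurableType d) (R : realType).
Variables (mu : {measure set T -> \bar R}) (p : \bar R) (p1 : (1 <= p)%E).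

Local Notation lfun := (LfunType mu p1).
Local Notation lspace := (LspaceType mu p1).
Local Notation amfun := (aeEqMfun (measurableTypeR R) mu).

HB.instance Definition _ := gen_eqMixin lspace.
HB.instance Definition _ := gen_choiceMixin lspace.

Lemma Lspace_repr_Lfun (f : lspace) : (f : T -> R) \in Lfun mu p.
Proof.
apply/andP; split; rewrite inE/=.
  exact: (@measurable_funPT _ _ _ _ (repr (f : amfun))).
exact: Lebesgue_finite.
Qed.

Definition Lspace_repr (f : lspace) : lfun := Lfun_Sub p1 (Lspace_repr_Lfun f).

Lemma Lfun_mfun (f : lfun) :
  (f : T -> R) \in @mfun _ _ T (measurableTypeR R).
Proof. by rewrite inE; exact: (@measurable_funPT _ _ _ _ f). Qed.

Local Notation pi f :=
  (\pi_amfun (@mfun_Sub _ _ T (measurableTypeR R) _ (Lfun_mfun f))).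

Lemma ae_eq_repr_pi (f : lfun) :
  ((pi f : amfun) : T -> R) = (f : T -> R) %[ae mu].
Proof.
have : \pi_amfun (repr (pi f)) = pi f by rewrite reprK.
by move=> /eqP; rewrite eqmodE => /asboolP.
Qed.

Lemma finite_norm_pi (f : lfun) : finite_norm mu p (pi f : amfun).
Proof.
rewrite /finite_norm (@ae_eq_Lnorm _ _ _ _ _ _ f p1)//.
- exact: (@Lfunction_finite _ _ _ _ _ _ f).
- exact: (@measurable_funPT _ _ _ _ (repr (pi f))).
- exact: ae_eq_repr_pi.
Qed.

Definition Lspace_class (f : lfun) : lspace :=
  HB.pack_for lspace (pi f)
    (isFinLebesgue.Build d T R mu p p1 (pi f) (finite_norm_pi f)).

Lemma Lspace_reprK : cancel Lspace_repr Lspace_class.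
Proof.
move=> [f [[ff]]]; rewrite /Lspace_class.
move: (finite_norm_pi _); set g := pi _; have gf : g = f.
  rewrite -[RHS]reprK; congr (\pi_amfun _).
  exact/val_inj.
rewrite gf => ff'.
by rewrite (Prop_irrelevance ff ff').
Qed.

Lemma Lspace_classK (f : lfun) :
  (Lspace_repr (Lspace_class f) : T -> R) = (f : T -> R) %[ae mu].
Proof. exact: ae_eq_repr_pi. Qed.

Lemma eq_Lspace_class (f g : lfun) :
  (f : T -> R) = (g : T -> R) %[ae mu] -> Lspace_class f = Lspace_class g.
Proof.
move=> fg; rewrite /Lspace_class.
have e : pi f = pi g by apply/eqP; rewrite eqmodE; exact/asboolP.
move: (finite_norm_pi f) (finite_norm_pi g); rewrite e => a b.
by rewrite (Prop_irrelevance a b).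
Qed.

Definition Lspace_zero : lspace := Lspace_class 0.
Definition Lspace_opp (f : lspace) : lspace := Lspace_class (- Lspace_repr f).
Definition Lspace_add (f g : lspace) : lspace :=
  Lspace_class (Lspace_repr f + Lspace_repr g).
Definition Lspace_scale (a : R) (f : lspace) : lspace :=
  Lspace_class (a *: Lspace_repr f).
Definition Lspace_norm (f : lspace) : R := fine 'N[mu]_p[EFin \o f]%E.

Let classN (f : lfun) : Lspace_opp (Lspace_class f) = Lspace_class (- f).
Proof.
apply: eq_Lspace_class; apply: filterS (Lspace_classK f) => x + _.
by move=> /(_ I) /= fx; congr (- _).
Qed.

Let classD (f g : lfun) :
  Lspace_add (Lspace_class f) (Lspace_class g) = Lspace_class (f + g).
Proof.
apply: eq_Lspace_class.
apply: filterS2 (Lspace_classK f) (Lspace_classK g) => x + + _.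
by move=> /(_ I) /= + /(_ I) /= => fx gx; congr (_ + _).
Qed.

Let classZ a (f : lfun) :
  Lspace_scale a (Lspace_class f) = Lspace_class (a *: f).
Proof.
apply: eq_Lspace_class; apply: filterS (Lspace_classK f) => x + _.
by move=> /(_ I) /= => fx; congr (_ * _).
Qed.

Let Lspace_ind (P : lspace -> Prop) :
  (forall f, P (Lspace_class f)) -> forall f, P f.
Proof. by move=> Pc f; rewrite -[f]Lspace_reprK. Qed.

Let addA : associative Lspace_add.
Proof.
elim/Lspace_ind=> f; elim/Lspace_ind=> g; elim/Lspace_ind=> h.
by rewrite !classD addrA.
Qed.

Let addC : commutative Lspace_add.
Proof. by move=> f g; rewrite /Lspace_add addrC. Qed.

Let add0 : left_id Lspace_zero Lspace_add.
Proof. by elim/Lspace_ind=> f; rewrite classD add0r. Qed.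

Let addN : left_inverse Lspace_zero Lspace_opp Lspace_add.
Proof. by elim/Lspace_ind=> f; rewrite classN classD addNr. Qed.

HB.instance Definition _ := GRing.isZmodule.Build lspace addA addC add0 addN.

Let scaleA a b (f : lspace) :
  Lspace_scale a (Lspace_scale b f) = Lspace_scale (a * b) f.
Proof. by elim/Lspace_ind: f => f; rewrite !classZ scalerA. Qed.

Let scale1 : left_id 1 Lspace_scale.
Proof. by elim/Lspace_ind=> f; rewrite classZ scale1r. Qed.

Let scaleDr : right_distributive Lspace_scale +%R.
Proof.
move=> a; elim/Lspace_ind=> f; elim/Lspace_ind=> g.
by rewrite [_ + _]classD !classZ [RHS]classD scalerDr.
Qed.

Let scaleDl (f : lspace) :
  {morph Lspace_scale^~ f : a b / a + b >-> a + b}.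
Proof.
by elim/Lspace_ind: f => f a b; rewrite !classZ [RHS]classD scalerDl.
Qed.

HB.instance Definition _ := GRing.Zmodule_isLmodule.Build R lspace
  scaleA scale1 scaleDr scaleDl.

Let norm_class (f : lfun) :
  Lspace_norm (Lspace_class f) = fine 'N[mu]_p[EFin \o f]%E.
Proof.
congr fine; apply: ae_eq_Lnorm => //.
- exact: (@measurable_funPT _ _ _ _ (Lspace_repr (Lspace_class f))).
- exact: Lspace_classK.
Qed.

Let normD (f g : lspace) : Lspace_norm (f + g) <= Lspace_norm f + Lspace_norm g.
Proof.
elim/Lspace_ind: f => f; elim/Lspace_ind: g => g.
by rewrite [_ + _]classD !norm_class ler_LnormD.
Qed.

Let normZ a (f : lspace) : Lspace_norm (a *: f) = `|a| * Lspace_norm f.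
Proof.
elim/Lspace_ind: f => f.
apply/EFin_inj; rewrite EFinM [_ *: _]classZ !norm_class.
by rewrite !finite_norm_fine LnormZ.
Qed.

Let norm0_eq0 (f : lspace) : Lspace_norm f = 0 -> f = 0.
Proof.
elim/Lspace_ind: f => f; rewrite norm_class => /fine_Lnormr_eq0 f0.
exact: eq_Lspace_class.
Qed.

HB.instance Definition _ := Lmodule_isNormed.Build R lspace
  normD normZ norm0_eq0.

Lemma LspaceP (f g : lspace) :
  f = g <-> (f : T -> R) = (g : T -> R) %[ae mu].
Proof.
split=> [->|fg]; first exact: ae_eq_refl.
by rewrite -[f]Lspace_reprK -[g]Lspace_reprK; exact: eq_Lspace_class.
Qed.

Lemma Lspace_addE (f g : lspace) :
  ((f + g : lspace) : T -> R) = (fun x => (f : T -> R) x + (g : T -> R) x)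
  %[ae mu].
Proof. exact: Lspace_classK (Lspace_repr f + Lspace_repr g). Qed.

Lemma Lspace_scaleE (a : R) (f : lspace) :
  ((a *: f : lspace) : T -> R) = (fun x => a * (f : T -> R) x) %[ae mu].
Proof. exact: Lspace_classK (a *: Lspace_repr f). Qed.

Lemma Lspace_normE (f : lspace) :
  (`|f|%:E = 'N[mu]_p[EFin \o (f : T -> R)])%E.
Proof. exact: (finite_norm_fine (Lspace_repr f)). Qed.

End Lspace_normed.

Lemma Lspace1_normE d (T : measurableType d) (R : realType)
    (mu : {measure set T -> \bar R}) (f : LspaceType1 mu) :
  (`|f|%:E = \int[mu]_x `|((f : T -> R) x)%:E|)%E.
Proof. by rewrite Lspace_normE Lnorm1. Qed.

Section perfect_daugavet.
Context (R : realType) (X : normedModType R).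

Definition unit_ball : set X := [set x | `|x| <= 1].

Definition unit_sphere : set X := [set x | `|x| = 1].

Definition slice (S : set X) : Prop :=
  exists (f : {linear X -> R^o}) (alpha : R),
    [/\ continuous f, 0 < alpha &
        S = unit_ball `&` [set x | sup (f @` unit_ball) - alpha < f x]].

(* A cardinal is represented by any type K of that cardinality, and
   {y_a : a < kappa} by a set Y with at most as many elements as K. *)
Definition perfect_daugavet (K : Type) : Prop :=
  forall Y : set X, Y `<=` unit_sphere -> Y #<= [set: K] ->
  forall S : set X, slice S ->
  exists2 x, S x & forall y, Y y -> `|y + x| = 2.

(* pDau(X) = |K|: the cardinal of K is the least one for which the perfect
   Daugavet property fails; this determines K up to bijection. *)
Definition pDau_is (K : Type) : Prop :=
  ~ perfect_daugavet K /\
  forall J : Type, ~ perfect_daugavet J -> [set: K] #<= [set: J].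

End perfect_daugavet.

Arguments perfect_daugavet {R} X K.
Arguments pDau_is {R} X K.

(* Main.v *)
(* Fix y with ||y|| = 1 and let F x = int sgn(y) x, a functional of norm 1 with
   F y = 1.  If ||x|| <= 1 and ||x - y|| = 2, then |x - y| = |x| + |y| almost
   everywhere, so x y <= 0 almost everywhere and F x <= 0.  Hence no point of
   the slice {x in B : F x > 0} is at distance 2 from y, and the 1-perfect
   property fails at the single point -y.  The 0-perfect property only asks
   that slices be nonempty. *)
From HB Require Import structures.
Require Import Defs.
From mathcomp Require Import all_boot all_order all_algebra.
From mathcomp Require Import all_classical all_reals all_analysis.
From mathcomp Require Import measurable_realfun.
Import Order.TTheory GRing.Theory Num.Theory.
Import numFieldNormedType.Exports.

Local Open Scope classical_set_scope.
Local Open Scope ring_scope.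

(** [sup] takes the default value 0 on a set that is unbounded above, so the threshold of a slice is
    meaningful only once this is known. *)
Lemma has_sup_image_unit_ball {R : realType} {X : normedModType R}
    {f : {linear X -> R^o}} :
  continuous f -> has_sup (f @` @unit_ball R X).
Proof.
move=> fc; have [M [_ fM]] := continuous_linear_bounded 0 (fc 0).
split; first by exists (f 0); exists 0 => //; rewrite /unit_ball/= normr0.
have := fM (M + 1); rewrite ltrDl ltr01 => /(_ isT).
move=> /nbhs_ballP[e /= e0 fe].
(* Scaling by [e / 2] sends the closed unit ball into the open ball of radius [e], where [|f|] is at
   most [M + 1]. *)
exists ((e / 2)^-1 * (M + 1)) => _ [x x1 <-].
have e20 : 0 < e / 2 by rewrite divr_gt0.
rewrite -ler_pdivrMl ?invr_gt0// invrK.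
have : ball 0 e ((e / 2) *: x).
  rewrite -ball_normE/= sub0r normrN normrZ gtr0_norm//.
  rewrite (le_lt_trans (y := e / 2))// ?ler_piMr// ?ltW//.
  by rewrite ltr_pdivrMr// mulr_natr mulr2n ltrDl.
move=> /fe/=; rewrite linearZ/=; apply: le_trans.
exact: ler_norm.
Qed.

(** A functional takes values on the ball arbitrarily close to its supremum there. This is all that
    the perfect Daugavet property demands of an empty family. *)
Lemma slice_neq0 {R : realType} {X : normedModType R} {S : set X} :
  slice S -> S !=set0.
Proof.
move=> [f [a [fc a0 ->]]].
have [_ [x x1 <-] fx] := sup_adherent a0 (has_sup_image_unit_ball fc).
by exists x.
Qed.

Lemma Lspace1_integrable {d} {T : measurableType d} {R : realType}
    {mu : {measure set T -> \bar R}} (f : LspaceType1 mu) :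
  mu.-integrable setT (EFin \o (f : T -> R)).
Proof. by apply/Lfun1_integrable; exact: Lspace_repr_Lfun. Qed.

Lemma Lspace1_measurable {d} {T : measurableType d} {R : realType}
    {mu : {measure set T -> \bar R}} (f : LspaceType1 mu) :
  measurable_fun setT (f : T -> R).
Proof.
by apply/measurable_EFinP; exact: measurable_int (Lspace1_integrable f).
Qed.

Lemma Lspace1_norm_Rintegral {d} {T : measurableType d} {R : realType}
    {mu : {measure set T -> \bar R}} (f : LspaceType1 mu) :
  `|f| = \int[mu]_x `|(f : T -> R) x|.
Proof. exact: (congr1 fine (Lspace1_normE f)). Qed.

Lemma ae_eq_Rintegral {d} {T : measurableType d} {R : realType}
    {mu : {measure set T -> \bar R}} {f g : T -> R} :
  measurable_fun setT f -> measurable_fun setT g -> f = g %[ae mu] ->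
  \int[mu]_x f x = \int[mu]_x g x.
Proof.
move=> mf mg fg; rewrite /Rintegral (ae_eq_integral (EFin \o g)) => //;
  try exact/measurable_EFinP.
by apply: filterS fg => x /[apply] /= ->.
Qed.

Lemma integrable_mul_le1 {d} {T : measurableType d} {R : realType}
    {mu : {measure set T -> \bar R}} {g f : T -> R} :
  measurable_fun setT g -> (forall x, `|g x| <= 1) ->
  mu.-integrable setT (EFin \o f) ->
  mu.-integrable setT (EFin \o (fun x => g x * f x)).
Proof.
move=> mg g1 fi; apply: (le_integrable _ _ _ fi) => //.
  apply/measurable_EFinP/measurable_funM => //.
  by apply/measurable_EFinP; exact: measurable_int fi.
by move=> x _ /=; rewrite lee_fin normrM ler_piMl.
Qed.

(** The part of the duality between [L_1] and bounded functions that is needed to integrate against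
    a sign function. *)
Lemma pairing_continuous_linear {d} {T : measurableType d} {R : realType}
    {mu : {measure set T -> \bar R}} {g : T -> R} :
  measurable_fun setT g -> (forall x, `|g x| <= 1) ->
  exists2 F : {linear LspaceType1 mu -> R^o},
    continuous F &
    forall f : LspaceType1 mu, F f = \int[mu]_x (g x * (f : T -> R) x).
Proof.
move=> mg g1.
pose F (f : LspaceType1 mu) : R^o := \int[mu]_x (g x * (f : T -> R) x).
have gi (f : LspaceType1 mu) := integrable_mul_le1 mg g1
  (Lspace1_integrable f).
have mfun (f : LspaceType1 mu) := Lspace1_measurable f.
have Fl : linear F.
  move=> a u v; rewrite /F.
  rewrite (_ : a *: _ = a * \int[mu]_x (g x * (u : T -> R) x))//.
  rewrite -RintegralZl// -RintegralD//; last first.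
    have := integrableZl measurableT a (gi u).
    by apply: eq_integrable => // x _ /=; rewrite EFinM.
  (* The chosen representative of [a *: u + v] agrees with the combination of representatives only
     almost everywhere. *)
  apply: ae_eq_Rintegral.
  - exact: measurable_funM.
  - apply: measurable_funD; by repeat apply: measurable_funM.
  - apply: filterS2 (Lspace_addE (a *: u) v) (Lspace_scaleE a u) => x.
    move=> + + _ => /(_ I) /= -> /(_ I) /= ->.
    by rewrite mulrDr mulrCA.
pose L : {linear LspaceType1 mu -> R^o} :=
  HB.pack F (GRing.isLinear.Build _ _ _ _ F Fl).
exists L => //; apply: bounded_linear_continuous.
(* On the open unit ball the value at [f] is at most [|f| < 1 < M] in modulus, because [|g| <= 1]
   pointwise. *)
exists 1; split => // M M1.
apply/nbhs_ballP; exists 1 => //= f; rewrite -ball_normE/= sub0r normrN => f1.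
rewrite (le_trans _ (ltW M1))// (le_trans _ (ltW f1))//.
rewrite (le_trans (le_normr_Rintegral _ (gi f)))//.
rewrite Lspace1_norm_Rintegral le_Rintegral//.
- exact: integrable_norm (gi f).
- exact: integrable_norm (Lspace1_integrable f).
- by move=> x _; rewrite normrM ler_piMl.
Qed.

(** Squaring [|a + b| = |a| + |b|] and cancelling the squares leaves [a * b = |a * b|]. *)
Lemma normD_eq_mul_ge0 (R : realDomainType) (a b : R) :
  `|a| + `|b| - `|a + b| = 0 -> 0 <= a * b.
Proof.
move=> /eqP; rewrite subr_eq0 eq_sym => /eqP ab.
have : (`|a + b|) ^+ 2 = (`|a| + `|b|) ^+ 2 by rewrite ab.
rewrite real_normK ?num_real// !sqrrD !real_normK ?num_real//.
move=> /(addIr _)/addrI/eqP; rewrite -normrM eqrMn2r//.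
by move=> /eqP ->.
Qed.

(** The pointwise defect [h] in the triangle inequality is nonnegative and has integral zero, so it
    vanishes almost everywhere. *)
Lemma Lspace1_normD_ae {d} {T : measurableType d} {R : realType}
    {mu : {measure set T -> \bar R}} {f g : LspaceType1 mu} :
  `|f + g| = `|f| + `|g| ->
  {ae mu, forall x, 0 <= (f : T -> R) x * (g : T -> R) x}.
Proof.
move=> fg.
pose h x := `|(f : T -> R) x| + `|(g : T -> R) x|
            - `|(f : T -> R) x + (g : T -> R) x|.
have fi := Lspace1_integrable f.
have gi := Lspace1_integrable g.
have fgi : mu.-integrable setT
    (EFin \o (fun x => (f : T -> R) x + (g : T -> R) x)).
  exact: integrableD fi gi.
have nfgi : mu.-integrable setT
    (EFin \o (fun x => `|(f : T -> R) x| + `|(g : T -> R) x|)).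
  exact: (integrableD measurableT (integrable_norm fi) (integrable_norm gi)).
have hi : mu.-integrable setT (EFin \o h).
  exact: (integrableB measurableT nfgi (integrable_norm fgi)).
have h0 : \int[mu]_x h x = 0.
  rewrite RintegralB//; last exact: integrable_norm fgi.
  rewrite RintegralD//; [|exact: integrable_norm fi|exact: integrable_norm gi].
  rewrite -!Lspace1_norm_Rintegral -fg Lspace1_norm_Rintegral.
  apply/eqP; rewrite subr_eq0; apply/eqP; apply: ae_eq_Rintegral.
  - by apply: measurableT_comp => //; exact: Lspace1_measurable.
  - apply: measurableT_comp => //; apply: measurable_funD;
      exact: Lspace1_measurable.
  - by apply: filterS (Lspace_addE f g) => x /[apply] ->.
have : (\int[mu]_x `|(EFin \o h) x|)%E = 0%E.
  under eq_integral do rewrite /= ger0_norm ?subr_ge0 ?ler_normD//.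
  by rewrite -[LHS]fineK ?integrable_fin_num// -[fine _]/(Rintegral _ _ _) h0.
move=> /(ae_eq_integral_abs mu measurableT (measurable_int mu hi)).
apply: filterS => x /(_ I) /= [].
exact: normD_eq_mul_ge0.
Qed.

Lemma measurable_fun_sg {d} {T : measurableType d} {R : realType}
    {f : T -> R} :
  measurable_fun setT f -> measurable_fun setT (fun x => Num.sg (f x)).
Proof.
move=> mf; rewrite /Num.sg; apply: measurable_fun_ifT => //.
  exact: measurable_fun_eqr.
apply: measurable_fun_ifT => //.
exact: measurable_fun_ltr.
Qed.

Lemma not_perfect_daugavet_L1 (R : realType) d (T : measurableType d)
    {mu : {measure set T -> \bar R}} :
  [set: LspaceType1 mu] <> [set 0] ->
  ~ perfect_daugavet (LspaceType1 mu) 'I_1.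
Proof.
move=> X0 pd.
have [y y1] : exists y : LspaceType1 mu, `|y| = 1.
  apply: contrapT => ny; apply: X0; apply/seteqP; split => // z _ /=.
  apply: contrapT => /eqP z0; apply: ny; exists (`|z|^-1 *: z).
  by rewrite normrZ normfV normr_id mulVf// normr_eq0.
have my : measurable_fun setT (y : T -> R) by exact: Lspace1_measurable.
have sg1 x : `|Num.sg ((y : T -> R) x)| <= 1.
  by rewrite normr_sg lern1 leq_b1.
have [F Fc FE] := pairing_continuous_linear (mu := mu)
  (measurable_fun_sg my) sg1.
have Fy : F y = 1.
  rewrite FE -[RHS]y1 Lspace1_norm_Rintegral.
  by apply: eq_Rintegral => t _; rewrite normrEsg.
have hs := has_sup_image_unit_ball Fc.
pose s := sup (F @` @unit_ball R (LspaceType1 mu)).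
have s0 : 0 < s.
  rewrite (lt_le_trans ltr01)// -Fy; apply: sup_upper_bound => //.
  by exists y => //; rewrite /unit_ball/= y1.
have sphN : [set - y] `<=` @unit_sphere R (LspaceType1 mu).
  by move=> _ ->; rewrite /unit_sphere/= normrN.
have card1 : ([set - y] #<= [set: 'I_1])%card.
  have -> : [set - y] = (fun=> - y) @` [set: 'I_1].
    by apply/seteqP; split => [_ ->|_ [_ _ <-]//]; exists ord0.
  exact: card_image_le.
(* Taking the width equal to the supremum [s] itself puts the threshold at 0; this is allowed since
   [s >= F y = 1]. *)
have slF : slice (@unit_ball R (LspaceType1 mu) `&` [set x | s - s < F x]).
  by exists F, s; split.
have [x [x1]] := pd _ sphN card1 _ slF.
rewrite /= subrr => Fx /(_ _ erefl) yx2.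
(* Since [x] has norm at most 1, the value 2 forces equality in the triangle inequality. *)
have yx : `|(- y) + x| = `|- y| + `|x|.
  apply/eqP; rewrite eq_le ler_normD/= yx2 normrN y1.
  by rewrite -[leRHS]/(1 + 1) lerD2l.
suff : F x <= 0 by rewrite leNgt Fx.
pose h t := Num.sg ((y : T -> R) t) * (x : T -> R) t.
have hi : mu.-integrable setT (EFin \o h).
  exact: integrable_mul_le1 (measurable_fun_sg my) sg1 (Lspace1_integrable x).
have mh : measurable_fun setT h.
  by apply/measurable_EFinP; exact: measurable_int hi.
(* [h] has the sign of [y * x], hence is almost everywhere nonpositive and equal to [- |h|], which
   makes the sign of [F x] visible. *)
rewrite FE (@ae_eq_Rintegral _ _ _ mu _ (fun t => -1 * `|h t|)) //.
- rewrite RintegralZl//; last exact: integrable_norm hi.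
  by rewrite mulN1r oppr_le0 Rintegral_ge0.
- by apply: measurable_funM => //; exact: measurableT_comp.
- have := Lspace_scaleE (-1) y; rewrite scaleN1r => Ny.
  apply: filterS2 Ny (Lspace1_normD_ae yx) => t + + _.
  move=> /(_ I) /= -> yxt; rewrite mulN1r.
  suff ht0 : h t <= 0 by rewrite -[LHS]opprK ler0_norm.
  rewrite mulN1r mulNr oppr_ge0 in yxt.
  by rewrite -sgr_le0 /h sgrM sgr_id -sgrM sgr_le0.
Qed.

Theorem proposition7p3 (R : realType) (d : measure_display)
    (T : measurableType d) (mu : {measure set T -> \bar R}) :
  [set: LspaceType1 mu] <> [set 0] -> pDau_is (LspaceType1 mu) 'I_1.
Proof.
move=> X0; split; first exact: not_perfect_daugavet_L1.
(* Minimality is the 0-perfect property: if ['I_1] did not embed in [J], then [J] and with it [Y]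
   would be empty, and any point of the slice would do. *)
move=> J nJ; apply: contrapT => nle; apply: nJ => Y _ YJ S /slice_neq0[x Sx].
exists x => // y Yy; exfalso; apply: nle.
have [j _] : [set: J] !=set0.
  apply/set0P/eqP => J0; move: YJ; rewrite J0 card_le0 => /eqP Y0.
  by rewrite Y0 in Yy.
have -> : [set: 'I_1] = (fun=> ord0) @` [set: J].
  by apply/seteqP; split => // i _; exists j; rewrite // (ord1 i).
exact: card_image_le.
Qed.
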